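(* Let $p\ge 3$ be an odd integer and let $\lambda\ge\lambda_p$ be a real number. Then the map $f_{p,\lambda}\colon[0,1]\to[0,1]$ (constructed in the context) is of type $p$ for Sharkovskii's order.
   Context: For odd $p\ge 3$, $\lambda_p$ denotes the unique positive root of $X^p-2X^{p-2}-1$; one has $\lambda_p>\sqrt2>1$. Sharkovskii's order is the total ordering on the positive integers $$3\lhd 5\lhd 7\lhd\cdots\lhd 2\cdot 3\lhd 2\cdot 5\lhd\cdots\lhd 2^2\cdot 3\lhd 2^2\cdot 5\lhd\cdots\lhd 2^3\lhd 2^2\lhd 2\lhd 1$$ (first all odd integers $n>1$ in increasing order, then successively $2$ times, $2^2$ times, $\ldots$, $2^k$ times, $\ldots$ the odd integers $n>1$, and finally all powers of $2$ in decreasing order). $m\unrhd n$ means $n\lhd m$ or $m=n$. A point $x$ is periodic of period $n$ for $f$ if $n$ is the least positive integer with $f^n(x)=x$. For a positive integer $n$, a continuous map $f$ of a compact nondegenerate interval into itself is of type $n$ (for Sharkovskii's order) if the set of periods of periodic points of $f$ is exactly $\{m\ge 1\mid m\unrhd n\}$. Construction of $f=f_{p,\lambda}$. Fix an odd integer $p\ge 3$ and a real $\lambda\ge\lambda_p$. Set $x_{p-1}:=1$, $x_{p-2}:=0$, $x_{p-3}:=\frac1\lambda$ and, for every integer $i$ with $0\le i\le p-4$ (no such $i$ if $p=3$), $$x_i:=\frac{(-1)^i}{\lambda^{p-i-2}}\sum_{j=0}^{p-i-3}(-\lambda)^j .$$ Set $$t:=1-\frac{x_0}{\lambda}=\frac{1}{\lambda^{p-1}}\Bigl(\lambda^{p-1}-\sum_{j=0}^{p-3}(-\lambda)^j\Bigr).$$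 These points satisfy $x_{i+1}=1-\lambda x_i$ for $0\le i\le p-4$, $x_0=\lambda(1-t)$, and are ordered as $$0=x_{p-2}<x_{p-4}<\cdots<x_1<x_0<x_2<x_4<\cdots<x_{p-3}=\tfrac1\lambda\le t<x_{p-1}=1$$ (for $p=3$: $0=x_1<x_0=\frac1\lambda\le t<x_2=1$). Let $s:=x_{p-4}$ if $p\ge 5$ and $s:=1$ if $p=3$. The map $f\colon[0,1]\to[0,1]$ is the continuous map defined by: - $f(x):=1-\lambda x$ for $x\in[0,\frac1\lambda]$; - $f(x):=\lambda(x-t)$ for $x\in[t,1]$; - if $t>\frac1\lambda$, put $\ell:=t-\frac1\lambda$, $k:=\lfloor\frac{\lambda\ell}{2s}\rfloor$, $J_i:=[\frac1\lambda+(i-1)\frac{2s}{\lambda},\frac1\lambda+i\frac{2s}{\lambda}]$ for $1\le i\le k$, and $K:=[\frac1\lambda+k\frac{2s}{\lambda},t]$ (possibly $k=0$, or $K=\{t\}$). On each $J=J_1,\ldots,J_k,K$, $f$ is the tent map that vanishes at both endpoints of $J$, is affine of slope $\lambda$ on the left half of $J$ and affine of slope $-\lambda$ on the right half of $J$ (so $f$ has maximum value $s$ on each $J_i$, and maximum value $<s$ on $K$). With this definition, $f(x_i)=x_{i+1}$ for $0\le i\le p-2$ and $f(x_{p-1})=x_0$. *)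

(* Defs.v *)
From mathcomp Require Import all_boot all_order all_algebra.
From mathcomp Require Import all_classical all_reals all_analysis.

Set Implicit Arguments.
Unset Strict Implicit.
Unset Printing Implicit Defensive.
Import Order.TTheory GRing.Theory Num.Theory.
Import numFieldNormedType.Exports.

Local Open Scope classical_set_scope.
Local Open Scope ring_scope.

(* [sharkovskii_lt n m] is n <| m, on positive integers:
   3 <| 5 <| ... <| 2.3 <| 2.5 <| ... <| 2^2.3 <| ... <| 2^2 <| 2 <| 1. *)
Inductive sharkovskii_lt : nat -> nat -> Prop :=
| SharkovskiiSameBlock (k q r : nat) :
    odd q -> odd r -> (1 < q)%N -> (q < r)%N ->
    sharkovskii_lt (2 ^ k * q) (2 ^ k * r)
| SharkovskiiBlocks (k l q r : nat) :
    odd q -> odd r -> (1 < q)%N -> (1 < r)%N -> (k < l)%N ->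
    sharkovskii_lt (2 ^ k * q) (2 ^ l * r)
| SharkovskiiBlockPow (k l q : nat) :
    odd q -> (1 < q)%N ->
    sharkovskii_lt (2 ^ k * q) (2 ^ l)
| SharkovskiiPows (k l : nat) :
    (l < k)%N ->
    sharkovskii_lt (2 ^ k) (2 ^ l).

(* [sharkovskii_ge m n] is m |>= n. *)
Definition sharkovskii_ge (m n : nat) : Prop := sharkovskii_lt n m \/ m = n.

Definition has_period (T : Type) (f : T -> T) (x : T) (n : nat) : Prop :=
  [/\ (0 < n)%N, iter n f x = x &
      forall m : nat, (0 < m < n)%N -> iter m f x <> x].

(* A map [a, b] -> [a, b] is a function on the whole of R that stabilises
   [a, b]; its values outside [a, b] are irrelevant. *)
Definition interval_map (R : realType) (a b : R) (f : R -> R) : Prop :=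
  [/\ a < b, {within `[a, b], continuous f} &
      forall x, x \in `[a, b] -> f x \in `[a, b]].

Definition periods (R : realType) (a b : R) (f : R -> R) : set nat :=
  [set m | exists2 x : R, x \in `[a, b] & has_period f x m].

Definition of_type (R : realType) (a b : R) (f : R -> R) (n : nat) : Prop :=
  interval_map a b f /\
  periods a b f = [set m : nat | (0 < m)%N /\ sharkovskii_ge m n].

(* The default value 0 is never used when p >= 3: there is exactly one
   positive root. *)
Definition lambda_ (R : realType) (p : nat) : R :=
  xget 0 [set x : R | 0 < x /\ root ('X^p - 2 *: 'X^(p - 2) - 1) x].

Section Construction.
Variables (R : realType) (p : nat) (lambda : R).

(* Meaningful for i < p only. *)
Definition orbit_point (i : nat) : R :=
  if i == (p - 1)%N then 1
  else if i == (p - 2)%N then 0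
  else if i == (p - 3)%N then 1 / lambda
  else (-1) ^+ i / lambda ^+ (p - i - 2)
       * \sum_(0 <= j < p - i - 2) (- lambda) ^+ j.

Definition t_point : R := 1 - orbit_point 0 / lambda.

Definition s_height : R := if (p == 3)%N then 1 else orbit_point (p - 4).

Definition gap_length : R := t_point - 1 / lambda.

(* The argument of truncn is nonnegative for lambda >= lambda_ p, so that
   truncn is the floor. *)
Definition num_tents : nat :=
  Num.truncn (lambda * gap_length / (2 * s_height)).

(* J_(i + 1) = [tent_endpoint i, tent_endpoint i.+1] for i < num_tents, and
   K = [tent_endpoint num_tents, t_point]. *)
Definition tent_endpoint (i : nat) : R :=
  1 / lambda + i%:R * (2 * s_height / lambda).

Definition tent (a b x : R) : R :=
  if x <= (a + b) / 2 then lambda * (x - a) else lambda * (b - x).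

(* Adjacent pieces agree (with value 0) at their common endpoints, so the
   order of the tests and the choice made by [pick] do not matter. *)
Definition f_map (x : R) : R :=
  if x <= 1 / lambda then 1 - lambda * x
  else if t_point <= x then lambda * (x - t_point)
  else if [pick i : 'I_num_tents
            | x \in `[tent_endpoint i, tent_endpoint i.+1]] is Some i
  then tent (tent_endpoint i) (tent_endpoint i.+1) x
  else tent (tent_endpoint num_tents) t_point x.

End Construction.

(* Main.v *)
(* With c = 1/(1+l) the fixed point of the left branch, f(c + u) = c - l u as
   long as c + u <= 1/l, and x_0 = c + c l^-(p-2).  A cycle which visits the
   right branch once, at y, and otherwise follows the left branch satisfies
   f(y) = c + w and y = c + (-l)^(m-1) w, a linear equation in w; its solution
   gives a genuine orbit of period m when m is even or m >= p.  Conversely,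
   for p >= 5, an orbit of odd period m > 1 must send some y > c to a point right
   of c; on (c, t) this is impossible since the tents have height s < c, so y > t
   and f(y) is in (c, x_0].  From there the orbit stays below 1/l for p - 2
   steps, whence m >= p. *)

Require Import Defs.
From mathcomp Require Import all_boot all_order all_algebra.
From mathcomp Require Import all_classical all_reals all_analysis.
From mathcomp Require Import ring lra zify.

Local Open Scope ring_scope.

Import Order.TTheory GRing.Theory Num.Theory.
Import numFieldNormedType.Exports.

(** * Sharkovskii's order seen from an odd integer *)

Lemma sharkovskii_lt_odd n m :
  sharkovskii_lt n m -> odd n -> [\/ ~~ odd m, m = 1%N | (n < m)%N].
Proof.
case=> [[|k] q r qo ro q1 qr|k [|l] q r qo ro q1 r1 kl|k [|l] q qo q1|
        [|k] l lk]; rewrite ?oddM ?oddX //= => _.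
- by constructor 3; rewrite !expn0 !mul1n.
- by constructor 1.
- by constructor 2.
- by constructor 1.
Qed.

Lemma sharkovskii_lt_1 p : odd p -> (1 < p)%N -> sharkovskii_lt p 1.
Proof. by move=> po p1; have := SharkovskiiBlockPow 0 0 po p1; rewrite mul1n. Qed.

(** Such an [m] is [2 ^ l * r] with [r] odd and [l > 0]: either a power of 2, or a member of a block
    after that of [p]. *)
Lemma sharkovskii_lt_even p m :
  odd p -> (1 < p)%N -> (0 < m)%N -> ~~ odd m -> sharkovskii_lt p m.
Proof.
move=> po p1 m0 me; have [r r2 mE] := pfactor_coprime (isT : prime 2) m0.
have ro : odd r by rewrite -coprime2n.
have l0 : (0 < logn 2 m)%N by rewrite logn_gt0 mem_primes m0 /= dvdn2.
rewrite mE mulnC -[p]mul1n -[X in (X * p)%N](expn0 2).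
have [r1|r1|r1] := ltngtP r 1%N; last by rewrite r1 muln1; constructor.
  by move: ro; move: r1; case: r {r2 mE}.
by constructor.
Qed.

Lemma sharkovskii_lt_bigger_odd p m :
  odd p -> (1 < p)%N -> odd m -> (p < m)%N -> sharkovskii_lt p m.
Proof.
move=> po p1 mo pm; have := SharkovskiiSameBlock 0 po mo p1 pm.
by rewrite !mul1n.
Qed.

(** * The number [lambda_ R p] *)

Lemma lambda_root (R : realType) (p : nat) : (3 <= p)%N ->
  0 < lambda_ R p /\ lambda_ R p ^+ (p - 2) * (lambda_ R p ^+ 2 - 2) = 1.
Proof.
move=> p3; pose P : {poly R} := 'X^p - 2 *: 'X^(p - 2) - 1.
have PE x : P.[x] = x ^+ (p - 2) * (x ^+ 2 - 2) - 1.
  rewrite /P !hornerE mulrBr -exprD subnK ?(leq_trans _ p3) //.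
  by rewrite [_ * 2]mulrC.
have [||x x12 rx] := @poly_ivt _ P 1 2; first by rewrite ler1n.
  rewrite !PE !expr1n; apply/andP; split; first by lra.
  have : (1 : R) <= 2 ^+ (p - 2) by rewrite exprn_ege1 // ler1n.
  set a := 2 ^+ _ => a1; lra.
(* With a root at hand, [xget] returns a genuine root and not its default value 0. *)
have : exists x, [set x : R | 0 < x /\ root P x]%classic x.
  by exists x; split=> //; case/andP: x12; lra.
move=> /(xgetPex 0)[l0 rl]; split=> //.
by move: rl; rewrite /root PE subr_eq0 => /eqP.
Qed.

(** The root equation forces [r ^+ 2 > 2], so both factors of [r ^+ (p - 2) * (r ^+ 2 - 2)] are
    positive and grow with [r]. *)
Lemma lambda_le_root (R : realType) (p : nat) (l : R) :
    (3 <= p)%N -> lambda_ R p <= l ->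
  1 < l /\ 1 <= l ^+ (p - 2) * (l ^+ 2 - 2).
Proof.
move=> p3 le_l; have [r0 rE] := lambda_root R p p3.
set r := lambda_ R p in r0 rE le_l.
have r2 : 0 < r ^+ 2 - 2.
  by rewrite -(pmulr_rgt0 _ (exprn_gt0 (p - 2) r0)) rE.
have rl2 : r ^+ 2 <= l ^+ 2 by rewrite lerXn2r // nnegrE; lra.
split; first by nra.
by rewrite -rE ler_pM ?exprn_ge0 ?lerB // ?lerXn2r ?nnegrE //; lra.
Qed.

(** * Tents as functions on the whole line *)

Section Tent.
Variables (R : realType) (l : R).
Hypothesis l0 : 0 < l.

(** The tent on [[a, b]] extended by 0: it is continuous everywhere, so that adjacent tents can be
    glued by adding them. *)
Definition bump (a b x : R) : R :=
  Num.max 0 (Num.min (l * (x - a)) (l * (b - x))).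

Lemma bumpE a b x : a <= x <= b -> tent l a b x = bump a b x.
Proof.
move=> /andP[ax xb]; rewrite /tent /bump; case: leP => xm.
  have le1 : l * (x - a) <= l * (b - x) by rewrite ler_pM2l //; lra.
  by rewrite (min_l le1) max_r // mulr_ge0 ?subr_ge0 // ltW.
have le1 : l * (b - x) <= l * (x - a) by rewrite ler_pM2l //; lra.
by rewrite (min_r le1) max_r // mulr_ge0 ?subr_ge0 // ltW.
Qed.

Lemma bump0l a b x : x <= a -> bump a b x = 0.
Proof.
move=> xa; rewrite /bump max_l // ge_min.
by rewrite mulr_ge0_le0 ?subr_le0 // ltW.
Qed.

Lemma bump0r a b x : b <= x -> bump a b x = 0.
Proof.
move=> bx; rewrite /bump max_l // ge_min orbC.
by rewrite mulr_ge0_le0 ?subr_le0 // ltW.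
Qed.

Lemma bump_ge0 a b x : 0 <= bump a b x.
Proof. by rewrite /bump le_max lexx. Qed.

Lemma tent_le a b x : tent l a b x <= l * (b - a) / 2.
Proof. by rewrite /tent -mulrA; case: (leP x) => xm; rewrite ler_pM2l //; lra. Qed.

Lemma bump_continuous a b : continuous (bump a b).
Proof.
move=> x; apply: (@continuous_max R _ (cst 0)
  (fun x => Num.min (l * (x - a)) (l * (b - x)))).
  exact: cvg_cst.
apply: (@continuous_min R _ (fun x => l * (x - a)) (fun x => l * (b - x))).
- apply: cvgM; first exact: cvg_cst.
  by apply: cvgB; [exact: cvg_id|exact: cvg_cst].
- apply: cvgM; first exact: cvg_cst.
  by apply: cvgB; [exact: cvg_cst|exact: cvg_id].
Qed.

End Tent.
Arguments bump {R}.

Lemma odd_ge5 n : odd n -> (3 <= n)%N -> n != 3%N -> (5 <= n)%N.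
Proof. by lia. Qed.

(** * Coordinates of [x_0], [t] and the tents *)

Section Map.
Variables (R : realType) (p : nat) (l : R).
Hypotheses (p_odd : odd p) (p_ge3 : (3 <= p)%N).
Hypotheses (l_gt1 : 1 < l) (l_root : 1 <= l ^+ (p - 2) * (l ^+ 2 - 2)).

Let c : R := (1 + l)^-1.
(* In the coordinate u = (x - c) / c, the point x_i is (-1)^i l^i d. *)
Let d : R := (l ^+ (p - 2))^-1.
Let f := f_map p l.
Let t := t_point p l.
Let s := s_height p l.
Let k := num_tents p l.
Let e := tent_endpoint p l.

Let l_gt0 : 0 < l. Proof. exact: lt_trans l_gt1. Qed.
Let l1_gt0 : 0 < 1 + l. Proof. exact: addr_gt0. Qed.
Let l_neq0 : l != 0. Proof. by rewrite gt_eqF. Qed.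
Let l1_neq0 : 1 + l != 0. Proof. by rewrite gt_eqF. Qed.
Let cE : c * (1 + l) = 1.
Proof. by rewrite /c mulVf. Qed.
Let c_gt0 : 0 < c. Proof. by rewrite /c invr_gt0. Qed.
Let d_gt0 : 0 < d. Proof. by rewrite /d invr_gt0 exprn_gt0. Qed.
Let d_le : d <= l ^+ 2 - 2.
Proof. by rewrite /d -[leLHS]mulr1 ler_pdivrMl ?exprn_gt0. Qed.
Let ldE : l * d = (l ^+ (p - 3))^-1.
Proof.
by rewrite /d -(subnSK p_ge3) exprS invfM mulrA divff ?mul1r.
Qed.
Let ld_le1 : l * d <= 1.
Proof. by rewrite ldE invf_le1 ?exprn_gt0 // exprn_ege1 // ltW. Qed.
Let linvE : l^-1 = c * (1 + l^-1).
Proof. by rewrite /c; field; rewrite l_neq0 l1_neq0. Qed.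

Lemma alternating_sum n :
  \sum_(0 <= j < n) (- l) ^+ j = c * (1 - (- l) ^+ n).
Proof.
have := subrX1 (- l) n; rewrite -(big_mkord xpredT (fun i => (- l) ^+ i)).
set S := \sum_(0 <= _ < _) _ => SE.
rewrite -[LHS]mul1r -[X in X * _]cE -mulrA; congr (_ * _).
by rewrite -opprB SE; ring.
Qed.

Lemma orbit_point0 : orbit_point p l 0 = c * (1 + d).
Proof.
have p1 : (1 < p)%N by exact: ltnW.
rewrite /orbit_point ltn_eqF ?subn_gt0 ?(ltnW p1) // ltn_eqF ?subn_gt0 //.
(* For [p = 3] the definition gives [1 / l], which agrees with the general formula because then
   [d = l^-1]. *)
rewrite eq_sym subn_eq0; case: leqP => [p_le3|_].
  have p3 : p = 3%N by apply/eqP; rewrite eqn_leq p_le3.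
  by rewrite mul1r linvE /d p3 expr1.
rewrite subn0 alternating_sum expr0 mul1r.
have -> : (- l) ^+ (p - 2) = - l ^+ (p - 2).
  by rewrite exprNn -signr_odd oddB ?p_odd ?mulN1r // ltnW.
rewrite -/d opprK mulrCA mulrDr mulr1 addrC mulVf //.
by rewrite expf_neq0.
Qed.

Lemma t_pointE : l * t = l - c * (1 + d).
Proof.
by rewrite /t /t_point orbit_point0 mulrBr mulr1 mulrCA divff ?mulr1.
Qed.

(** Multiplying [1 <= l - c * (1 + d)] by [1 + l] turns it into [d <= l ^+ 2 - 2], the form taken by
    the lower bound on [l]. *)
Lemma linv_le_t : l^-1 <= t.
Proof.
rewrite -(ler_pM2l l_gt0) t_pointE divff //.
move: (cE) (c_gt0) (d_gt0) (d_le) (l_gt1) => cE' c0 d0 dl l1; nra.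
Qed.

Lemma t_lt1 : t < 1.
Proof.
rewrite -(ltr_pM2l l_gt0) t_pointE mulr1.
move: (c_gt0) (d_gt0) => c0 d0; nra.
Qed.

Lemma s_heightE : s = if p == 3%N then 1 else c * (1 - (l ^+ 2)^-1).
Proof.
rewrite /s /s_height; case: eqVneq => // p3.
have p5 := odd_ge5 p p_odd p_ge3 p3; have p4 := ltnW p5.
rewrite /orbit_point !ltn_eqF ?ltn_sub2l ?(leq_trans _ p5) // subKn //.
rewrite alternating_sum -signr_odd oddB ?p_odd //= sqrrN.
by field; rewrite l_neq0 ?gt_eqF.
Qed.

Lemma s_height_gt0 : 0 < s.
Proof.
rewrite s_heightE; case: ifP => // _; apply: mulr_gt0 => //.
by rewrite subr_gt0 invf_lt1 ?exprn_gt0 // exprn_egt1.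
Qed.

Lemma s_height_ltc : p != 3%N -> s < c.
Proof.
move=> /negbTE p3; rewrite s_heightE p3 -[ltRHS]mulr1 ltr_pM2l //.
by rewrite gtrBl invr_gt0 exprn_gt0.
Qed.

Lemma s_height_le1 : s <= 1.
Proof.
have [p3|p3] := eqVneq p 3%N; first by rewrite s_heightE p3.
move: (s_height_ltc p3) (cE) (l_gt1) => sc cE' l1; nra.
Qed.

(** The two floor inequalities: what remains after [k] full tents is shorter than the base of one
    more. *)
Lemma num_tents_bounds :
  e k <= t /\ t - e k < 2 * s / l.
Proof.
have s0 := s_height_gt0; have lt := linv_le_t.
have sl : 0 < 2 * s / l by rewrite divr_gt0 // mulr_gt0.
have gE : gap_length p l = t - l^-1 by rewrite /gap_length mul1r.
have gE2 : l * gap_length p l / (2 * s) * (2 * s / l) = t - l^-1.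
  by rewrite gE; field; rewrite l_neq0 ?gt_eqF.
have : 0 <= l * gap_length p l / (2 * s).
  by rewrite divr_ge0 ?mulr_ge0 ?gE ?subr_ge0 // ltW // mulr_gt0.
move/truncn_itv/andP; rewrite -/(num_tents p l) -/k.
rewrite -(ler_pM2r sl) -(ltr_pM2r sl) gE2.
rewrite /e /tent_endpoint -/s mul1r -natr1 mulrDl mul1r => -[? ?].
by split; lra.
Qed.

Lemma tent_endpointD i j : e (i + j) = e i + j%:R * (2 * s / l).
Proof. by rewrite /e /tent_endpoint -/s natrD mulrDl addrA. Qed.

Lemma tent_endpoint_le i j : (i <= j)%N -> e i <= e j.
Proof.
move=> ij; rewrite -(subnKC ij) tent_endpointD lerDl.
by rewrite mulr_ge0 ?divr_ge0 ?mulr_ge0 // ltW // s_height_gt0.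
Qed.

Lemma tent_endpoint0 : e 0%N = l^-1.
Proof. by rewrite /e /tent_endpoint mul0r addr0 mul1r. Qed.

Lemma tent_endpoint_find x : l^-1 <= x -> x < e k ->
  exists i : 'I_k, e i <= x <= e i.+1.
Proof.
rewrite -tent_endpoint0; elim: k => [|n IHn] x0 xn; first by lra.
have [xn'|xn'] := ltP x (e n).
  by have [i ix] := IHn x0 xn'; exists (widen_ord (leqnSn n) i).
by exists ord_max; rewrite xn' ltW.
Qed.

(** * The branches of [f], its continuity and its range *)

Lemma f_left x : x <= l^-1 -> f x = 1 - l * x.
Proof. by move=> xl; rewrite /f /f_map mul1r xl. Qed.

Lemma f_right x : t <= x -> f x = l * (x - t).
Proof.
(* The left branch is tested first; it can apply here only if [x = t = l^-1], where both branches
   vanish. *)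
move=> tx; have lt := linv_le_t; have [xl|xl] := leP x l^-1.
  have xE : x = l^-1 by lra.
  have tE : t = l^-1 by lra.
  by rewrite f_left // tE xE divff ?gt_eqF // !subrr mulr0.
by rewrite /f /f_map mul1r leNgt xl /= -/t tx.
Qed.

(* Distinct pieces overlap only at endpoints, where the bumps vanish, so the
   choice made by [pick] is immaterial. *)
Lemma f_mid x : l^-1 < x -> x < t ->
  f x = \sum_(i < k) bump l (e i) (e i.+1) x + bump l (e k) t x /\ f x <= s.
Proof.
move=> lx xt; have [ekt tek] := num_tents_bounds.
(* A tent of slope [l] over a base of length [2 * s / l] has height [s]; the base of K is
   shorter. *)
have sE : s = l * (2 * s / l) / 2 by field.
rewrite /f /f_map mul1r leNgt lx /= -/t leNgt xt /=; case: pickP => [i|noi].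
  rewrite in_itv /= -/e => ix; have /andP[ix1 ix2] := ix; split.
    rewrite (bigD1 i) //= big1 => [|j ji].
      rewrite addr0 (bump0l _ _ l_gt0 (e k)) ?addr0 ?bumpE //.
      by rewrite (le_trans ix2) // tent_endpoint_le.
    have [ij|ij|/val_inj ij] := ltngtP i j; last by rewrite ij eqxx in ji.
      by rewrite bump0l // (le_trans ix2) // tent_endpoint_le.
    by rewrite bump0r // (le_trans _ ix1) // tent_endpoint_le.
  rewrite (le_trans (tent_le _ _ l_gt0 _ _ _)) //.
  by rewrite -[i.+1]addn1 tent_endpointD mul1r addrC addKr -sE.
have ekx : e k <= x.
  rewrite leNgt; apply/negP => xek.
  have [i ix] := tent_endpoint_find x (ltW lx) xek.
  by have := noi i; rewrite in_itv /= -/e ix.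
split.
  rewrite big1 => [|j _]; first by rewrite add0r bumpE // ekx ltW.
  by rewrite bump0r // (le_trans _ ekx) // tent_endpoint_le.
rewrite (le_trans (tent_le _ _ l_gt0 _ _ _)) // [leRHS]sE.
by rewrite ler_pM2r ?invr_gt0 // ler_pM2l // ltW.
Qed.

(** Each branch, truncated at 0, vanishes off its own piece. The sum makes continuity and
    nonnegativity immediate. *)
Lemma f_sum_of_bumps x :
  f x = Num.max 0 (1 - l * x) + Num.max 0 (l * (x - t))
        + (\sum_(i < k) bump l (e i) (e i.+1) x + bump l (e k) t x).
Proof.
have lt := linv_le_t; have [ekt _] := num_tents_bounds.
have ek : l^-1 <= e k by rewrite -tent_endpoint0 tent_endpoint_le.
have lV : l * l^-1 = 1 by rewrite divff ?gt_eqF.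
have left0 y : l^-1 <= y -> Num.max 0 (1 - l * y) = 0.
  by move=> ly; rewrite max_l // subr_le0 -lV ler_pM2l.
have right0 y : y <= t -> Num.max 0 (l * (y - t)) = 0.
  by move=> ly; rewrite max_l // pmulr_rle0 // subr_le0.
have [xl|lx] := leP x l^-1.
  rewrite f_left // right0; last by lra.
  rewrite max_r; last by rewrite subr_ge0 -lV ler_pM2l.
  rewrite big1 ?bump0l ?addr0 //; first by lra.
  move=> i _; rewrite bump0l // (le_trans xl) // -tent_endpoint0.
  exact: tent_endpoint_le.
rewrite left0 ?add0r; last exact: ltW.
have [tx|xt] := leP t x.
  rewrite f_right // max_r; last by rewrite pmulr_rge0 // subr_ge0.
  rewrite big1 ?bump0r ?addr0 // => i _; rewrite bump0r //.
  by rewrite (le_trans _ tx) // (le_trans _ ekt) // tent_endpoint_le.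
by rewrite right0 ?add0r ?ltW //; have [] := f_mid x lx xt.
Qed.

Lemma f_continuous : continuous f.
Proof.
rewrite (funext f_sum_of_bumps) => x.
apply: cvgD; last first.
  apply: cvgD; last exact: bump_continuous.
  by apply: cvg_big => // [|i _]; [exact: add_continuous|exact: bump_continuous].
apply: cvgD.
- apply: (@continuous_max R _ (cst 0) (fun x => 1 - l * x)).
    exact: cvg_cst.
  by apply: cvgB; [exact: cvg_cst|apply: cvgM; [exact: cvg_cst|exact: cvg_id]].
- apply: (@continuous_max R _ (cst 0) (fun x => l * (x - t))).
    exact: cvg_cst.
  by apply: cvgM; [exact: cvg_cst|apply: cvgB; [exact: cvg_id|exact: cvg_cst]].
Qed.

Lemma f_01 x : 0 <= x <= 1 -> 0 <= f x <= 1.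
Proof.
move=> /andP[x0 x1]; apply/andP; split.
  rewrite f_sum_of_bumps; apply: addr_ge0; apply: addr_ge0; rewrite ?bump_ge0 //;
    try by rewrite le_max lexx.
  by apply: sumr_ge0 => i _; exact: bump_ge0.
have [xl|lx] := leP x l^-1.
  rewrite f_left //; have lV : l * l^-1 = 1 by rewrite divff.
  have l0 := l_gt0; nra.
have [tx|xt] := leP t x.
  move: (t_pointE) (l_gt1) (ld_le1) (d_gt0) => tE l1 ld d0.
  (* The right branch is largest at 1, with value [x_0 = c * (1 + d)]; and [c * (1 + l) = 1]. *)
  have x0_le1 : c * (1 + d) <= c * (1 + l) by rewrite ler_pM2l //; nra.
  have lx1 : l * x <= l * 1 by rewrite ler_pM2l.
  move: x0_le1; rewrite f_right // cE; lra.
by have [_ /le_trans->] := f_mid x lx xt; rewrite // s_height_le1.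
Qed.

(** * Linear dynamics around [c] and the resulting cycles *)

Lemma f_fixed_point : f c = c.
Proof.
rewrite f_left; first by move: (cE); lra.
by rewrite linvE ler_pMr // lerDl invr_ge0 ltW.
Qed.

(** Since [l^-1 = c + c / l], the right-hand side is the test for [c + u] to be on the left
    branch. *)
Lemma le_linv u : (c + u <= l^-1) = (l * u <= c).
Proof. by rewrite linvE mulrDr mulr1 lerD2l ler_pdivlMr // mulrC. Qed.

Lemma f_linear u : l * u <= c -> f (c + u) = c - l * u.
Proof. by rewrite -le_linv => /f_left ->; move: (cE); lra. Qed.

Lemma iter_f_linear w n : (forall i, (i < n)%N -> l * ((- l) ^+ i * w) <= c) ->
  iter n f (c + w) = c + (- l) ^+ n * w.
Proof.
elim: n => [|n IHn] wn; first by rewrite expr0 mul1r.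
rewrite iterS IHn => [|i ni]; last by rewrite wn // ltnW.
by rewrite f_linear ?wn // exprS; ring.
Qed.

Lemma alternating_le w i : l * ((- l) ^+ i * w) <= l ^+ i.+1 * `|w|.
Proof.
rewrite (le_trans (ler_norm _)) // !normrM normrX normrN.
by rewrite !(gtr0_norm l_gt0) exprS mulrA.
Qed.

(* The equation says that [c + (-l)^n w] is mapped to [c + w] by the right
   branch, and the bounds say that [c + w] lies in [0, x_0]. *)
Lemma periodic_orbit n w :
    (l * (- l) ^+ n - 1) * w = c * (l ^+ 2 - d) ->
    0 < (- l) ^+ n * w -> - c <= w -> w <= c * d ->
  exists2 x, x \in `[0, 1] & has_period f x n.+1.
Proof.
set a := (- l) ^+ n => wE aw0 cw wcd; pose y := c + a * w.
have lV : l * l^-1 = 1 by rewrite divff.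
have w_neq0 : w != 0 by apply: contraTneq aw0 => ->; rewrite mulr0 ltxx.
have tE := t_pointE; have cE' := cE.
have fyE : l * (y - t) = c + w.
  have lcE : l * (c * (1 + l)) = l by rewrite cE mulr1.
  by rewrite /y mulrBr tE; lra.
have ty : t <= y by rewrite -subr_ge0 -(pmulr_rge0 _ l_gt0) fyE; lra.
have y1 : y <= 1 by rewrite -(lerD2r (- t)) -(ler_pM2l l_gt0) fyE mulrBr tE; lra.
have y0 : 0 < y by rewrite addr_gt0.
have awcl : a * w <= c * l by rewrite /y in y1; lra.
have step i : (i < n)%N -> l * ((- l) ^+ i * w) <= c.
  (* Equal parities give [i + 2 <= n], whence [l ^+ i.+2 * |w| <= a * w <= c * l]; otherwise
     [(- l) ^+ i * w] has the sign opposite to [a * w]. *)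
  move=> ni; have [odd_eq|odd_neq] := eqVneq (odd i) (odd n).
    have ni2 : (i.+2 <= n)%N by clear -ni odd_eq; lia.
    rewrite (le_trans (alternating_le _ _)) // -(ler_pM2r l_gt0).
    apply: le_trans awcl; rewrite -[leRHS]gtr0_norm // normrM normrX normrN.
    by rewrite (gtr0_norm l_gt0) mulrAC -exprSr ler_wpM2r // ler_eXn2l.
  apply: le_trans (ltW c_gt0); rewrite pmulr_rle0 //.
  move: aw0; rewrite /a (exprNn l i) (exprNn l n) -(signr_odd _ i) -(signr_odd _ n).
  have -> : odd n = ~~ odd i by case: (odd i) (odd n) odd_neq => -[].
  have := exprn_gt0 n l_gt0; have := exprn_gt0 i l_gt0.
  case: (odd i) => /= li ln; rewrite ?expr0 ?expr1 ?mul1r ?mulN1r ?mulNr.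
    by rewrite oppr_le0 pmulr_rgt0 // => w0; rewrite pmulr_rge0 // ltW.
  by rewrite oppr_gt0 pmulr_rlt0 // => w0; rewrite pmulr_rle0 // ltW.
have itE j : (j <= n)%N -> iter j.+1 f y = c + (- l) ^+ j * w.
  move=> jn; rewrite iterSr f_right // fyE iter_f_linear // => i ij.
  by rewrite step // (leq_trans ij).
exists y; first by rewrite in_itv /= y1 ltW.
split=> // [|[//|j] /= jn]; first by rewrite itE.
rewrite -iterS itE; last exact: ltnW.
(* An early return would give [(- l) ^+ j = (- l) ^+ n] with [j < n], which absolute values
   exclude. *)
move=> /addrI /(mulIf w_neq0) /(congr1 Num.norm).
rewrite !normrX normrN (gtr0_norm l_gt0) => /eqP.
by rewrite eq_le !ler_eXn2l // [(n <= j)%N]leqNgt (jn : (j < n)%N) andbF.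
Qed.

(** Here the linear equation has the negative solution [- c * v]; the bound [v <= 1] follows from
    [l ^+ 2 <= l ^+ n.+1]. *)
Lemma even_periodic_orbit n : odd n ->
  exists2 x, x \in `[0, 1] & has_period f x n.+1.
Proof.
move=> no; have ln1 : l ^+ 2 <= l ^+ n.+1.
  by rewrite ler_eXn2l //; case: n no.
have lE : (- l) ^+ n = - l ^+ n by rewrite exprNn -signr_odd no mulN1r.
have D0 : 0 < l ^+ n.+1 + 1 by rewrite addr_gt0 // exprn_gt0.
have N0 : 0 < l ^+ 2 - d by move: (d_le); lra.
pose v := (l ^+ 2 - d) / (l ^+ n.+1 + 1).
have v0 : 0 < v by rewrite divr_gt0.
have v1 : v <= 1 by rewrite ler_pdivrMr // mul1r; move: (d_gt0); lra.
have vE : v * (l ^+ n.+1 + 1) = l ^+ 2 - d by rewrite divfK // gt_eqF.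
apply: (periodic_orbit n (- c * v)).
- by rewrite -vE lE exprS; ring.
- by rewrite lE !mulNr mulrN opprK; rewrite mulr_gt0 ?exprn_gt0 // mulr_gt0.
- by rewrite mulNr lerN2 ler_piMr // ltW.
- by apply: (@le_trans _ _ 0); [rewrite mulNr oppr_le0|]; rewrite ltW // mulr_gt0.
Qed.

(** Here the solution [c * v] is positive, and [v <= d] amounts to [l ^+ 2 <= d * l ^+ n.+1], that
    is, [p <= n.+1]. *)
Lemma odd_periodic_orbit n : ~~ odd n -> (p <= n.+1)%N ->
  exists2 x, x \in `[0, 1] & has_period f x n.+1.
Proof.
move=> /negbTE ne pn.
have lE : (- l) ^+ n = l ^+ n by rewrite exprNn -signr_odd ne mul1r.
have D0 : 0 < l ^+ n.+1 - 1 by rewrite subr_gt0 exprn_egt1.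
have N0 : 0 < l ^+ 2 - d by move: (d_le); lra.
have dl2 : l ^+ 2 <= d * l ^+ n.+1.
  rewrite /d ler_pdivlMl ?exprn_gt0 // -exprD ler_eXn2l //.
  by rewrite subnK // ltnW.
pose v := (l ^+ 2 - d) / (l ^+ n.+1 - 1).
have v0 : 0 < v by rewrite divr_gt0.
have vd : v <= d by rewrite ler_pdivrMr //; lra.
have vE : v * (l ^+ n.+1 - 1) = l ^+ 2 - d by rewrite divfK // gt_eqF.
apply: (periodic_orbit n (c * v)).
- by rewrite -vE lE exprS; ring.
- by rewrite lE; rewrite mulr_gt0 ?exprn_gt0 // mulr_gt0.
- by apply: (@le_trans _ _ 0); rewrite ?oppr_le0 ltW // mulr_gt0.
- by rewrite ler_pM2l.
Qed.

(** * Lower bound on odd periods *)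

Lemma iter_f_01 i x : 0 <= x <= 1 -> 0 <= iter i f x <= 1.
Proof. by move=> x01; elim: i => //= i IHi; exact: f_01. Qed.

Lemma iter_mul_period m x j : iter m f x = x -> iter (j * m) f x = x.
Proof. by move=> mx; elim: j => // j IHj; rewrite mulSn iterD IHj. Qed.

(* Points left of [c] move right of it: an orbit which never stays to the right
   of [c] changes side at each step, so its period is even. *)
Lemma odd_orbit_stays_right m x : has_period f x m -> odd m -> m != 1%N ->
  exists2 i, c < iter i f x & c < f (iter i f x).
Proof.
move=> [m0 mx min] mo m1; apply: contrapT => noi.
have fpc i : iter i f c = c by elim: i => //= i ->; exact: f_fixed_point.
have m_gt1 : (1 < m)%N by rewrite ltn_neqAle eq_sym m1.
have xc i : iter i f x <> c.
  (* An orbit that meets [c] stays there; as it also returns to [x], this makes [x] the fixed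
     point. *)
  move=> ic; apply: (min 1%N); first by rewrite m_gt1.
  have xE : x = c.
    rewrite -(iter_mul_period m x i mx) -(subnK (leq_pmulr i m0)) iterD ic.
    exact: fpc.
  by rewrite xE /= f_fixed_point.
have side i : (c < iter i f x) = odd i (+) (c < x).
  elim: i => //= i IHi; rewrite addNb -IHi.
  case: (ltgtP (iter i f x) c) => [ic|ci|/xc//].
    have lic : l * (iter i f x - c) < 0 by rewrite pmulr_rlt0 // subr_lt0.
    rewrite -[X in f X](subrKC c) f_linear; first by lra.
    by rewrite ltW // (lt_trans lic).
  by apply/negP => fic; apply: noi; exists i.
by have := side m; rewrite mx mo; case: (c < x).
Qed.

Lemma odd_period_ge m x : x \in `[0, 1] -> has_period f x m -> odd m ->
  m != 1%N -> (p <= m)%N.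
Proof.
rewrite in_itv /= => x01 xm mo m1; rewrite leqNgt; apply/negP => mp.
have [i] := odd_orbit_stays_right m x xm mo m1.
have [m0 mx _] := xm.
have : iter m f (iter i f x) = iter i f x by rewrite -iterD addnC iterD mx.
have /andP[_] := iter_f_01 i x x01; move: (iter i f x) => {i} y y1 my cy cfy.
have p_neq3 : p != 3%N.
  by apply: contraTneq mp => ->; clear -m0 mo m1; lia.
have mp2 : (m <= p - 2)%N.
  by clear -mp p_odd mo; lia.
have ly : l^-1 < y.
  rewrite ltNge; apply/negP => yl; move: cfy.
  by rewrite f_left //; move: (l_gt0) (cE); nra.
have ty : t <= y.
  rewrite leNgt; apply/negP => yt.
  have [_ fys] := f_mid y ly yt.
  by have := s_height_ltc p_neq3; lra.
have w0 : 0 < f y - c by rewrite subr_gt0.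
have wcd : f y - c <= c * d.
  have ly1 : l * y <= l * 1 by rewrite ler_pM2l.
  by rewrite f_right //; move: (t_pointE); lra.
have small i : (i < p - 2)%N -> l * ((- l) ^+ i * (f y - c)) <= c.
  move=> ip; apply: (le_trans (alternating_le _ _)); rewrite gtr0_norm //.
  have li : l ^+ i.+1 <= l ^+ (p - 2) by rewrite ler_eXn2l.
  apply: (@le_trans _ _ (l ^+ (p - 2) * (c * d))).
    by rewrite ler_pM // ?exprn_ge0 // ltW.
  by rewrite mulrCA /d divff ?mulr1 // expf_neq0.
case: m m0 my mp2 {mx mo m1 mp xm} => // n _ my np.
(* By [small], the point [c + (- l) ^+ n * (f y - c)] is at most [l^-1]; by periodicity it is [y],
   which is larger. *)
move: my; rewrite iterSr -[f y](subrKC c) iter_f_linear => [yE|j jn].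
  by move: ly; rewrite ltNge -yE le_linv small.
by rewrite small // (leq_trans jn) // ltnW.
Qed.

End Map.

(** * The set of periods *)

Theorem proposition3p6 (R : realType) (p : nat) (lambda : R)
    (p_odd : odd p) (p_ge3 : (3 <= p)%N) (lambda_ge : lambda_ R p <= lambda) :
  of_type 0 1 (f_map p lambda) p.
Proof.
have [l_gt1 l_root] := lambda_le_root R p lambda p_ge3 lambda_ge.
have p_gt1 : (1 < p)%N by exact: ltnW.
split; first split=> //.
- by apply: continuous_subspaceT; exact: f_continuous.
- by move=> x; rewrite !in_itv /=; exact: f_01.
apply/seteqP; split=> m /=.
  move=> [x x01 xm]; have [m0 _ _] := xm; split=> //.
  have [mo|me] := boolP (odd m); last by left; exact: sharkovskii_lt_even.
  have [->|m1] := eqVneq m 1%N; first by left; exact: sharkovskii_lt_1.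
  have : (p <= m)%N by exact: odd_period_ge x01 xm mo m1.
  rewrite leq_eqVlt => /predU1P[->|pm]; first by right.
  by left; exact: sharkovskii_lt_bigger_odd.
move=> [m0 pm].
have {pm} : [\/ ~~ odd m, m = 1%N | odd m && (p <= m)%N].
  have [mo|] := boolP (odd m); last by constructor 1.
  case: pm => [/sharkovskii_lt_odd/(_ p_odd)[|m1|/ltnW pm]|->].
  - by rewrite mo.
  - by constructor 2.
  - by constructor 3.
  - by constructor 3; rewrite leqnn.
case=> [me|->|/andP[mo pm]].
- by case: m m0 me => // n _; rewrite negbK; exact: even_periodic_orbit.
- exists (1 + lambda)^-1.
    by rewrite in_itv /= invr_ge0 invf_le1; lra.
  by split=> // [|[]//]; exact: f_fixed_point.
- by case: m m0 mo pm => // n _; exact: odd_periodic_orbit.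
Qed.
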